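(* Let $p$ be a prime, $G$ a finite group of order $n$, $N/\mathbb{Q}_p$ a finite Galois extension containing all $n$-th roots of unity, and $\mathbb{Q}_p \subseteq K \subseteq M \subseteq N$ intermediate fields with $M/K$ Galois. Let $F \in \mathrm{Gal}(M/K)$ be a lift of the Frobenius automorphism of the residue fields, and let $\sigma \in \mathrm{Gal}(M/K)$ (so that $\sigma F\sigma^{-1}$ is also a lift of Frobenius). Then for every $z \in O_M[G]^*$, $$\mathrm{Log}_{\sigma F \sigma^{-1}}(\sigma(z)) = \sigma\cdot(\mathrm{Log}_F(z)).$$
   Context: $O_M, O_N$ are the valuation rings of $M,N$, $\pi_M$ is a uniformizer of $M$, and $O_K/\pi_K O_K = \mathbb{F}_{p^q}$; a lift of Frobenius $F \in \mathrm{Gal}(M/K)$ satisfies $F(z)\equiv z^{p^q} \pmod{\pi_M O_M}$ for all $z\in O_M$. Each $\sigma \in \mathrm{Gal}(M/K)$ (in particular $F$) acts on $O_M[G]$ by $\sigma(\sum_\gamma\lambda_\gamma\gamma) = \sum_\gamma \sigma(\lambda_\gamma)\gamma$. The complex representation ring $R(G)$ is identified with $K_0(N[G])$, generated by representations $T : G \to GL_u(N)$; $\mathrm{Gal}(N/K)$ acts on it by acting on matrix entries. $\psi^m$ denotes the $m$-th Adams operation on $R(G)$ (on characters, $\chi_{\psi^m(T)}(g)=\chi_T(g^m)$). The determinantal homomorphism $\mathrm{Det}: O_M[G]^* \to \mathrm{Hom}_{\mathrm{Gal}(N/M)}(R(G), O_N^* )$ is given on representations by $\mathrm{Det}(\sum_\gamma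 \lambda_\gamma\gamma)(T) = \det(\sum_\gamma\lambda_\gamma T(\gamma))$. For all $z\in O_M[G]^*$ and $T \in R(G)$ one has $\mathrm{Det}(F(z))(\psi^{p^q}(T))/(\mathrm{Det}(z)(T))^{p^q} \in 1+\pi_M O_N$, and $\mathrm{Log}_F : O_M[G]^* \to \mathrm{Hom}_{\mathrm{Gal}(N/M)}(R(G),N)$ is the homomorphism $$\mathrm{Log}_F(z)(T) = \log\left(\frac{\mathrm{Det}(F(z))(\psi^{p^q}(T))}{(\mathrm{Det}(z)(T))^{p^q}}\right),$$ where $\log(1+x) = \sum_{m\ge1}(-1)^{m-1}x^m/m$. $\sigma \in \mathrm{Gal}(M/K)$ acts on $f \in \mathrm{Hom}_{\mathrm{Gal}(N/M)}(R(G),N)$ by $(\sigma\cdot f)(T) = \tilde\sigma(f(\tilde\sigma^{-1}(T)))$, where $\tilde\sigma\in \mathrm{Gal}(N/K)$ is any lift of $\sigma$. *)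

(* Defs.v *)
From HB Require Import structures.
From mathcomp Require Import all_boot all_order all_fingroup all_algebra.
From mathcomp Require Import ssrAC all_solvable all_field all_character.
From mathcomp Require Import boolp classical_sets constructive_ereal.

Set Implicit Arguments.
Unset Strict Implicit.
Unset Printing Implicit Defensive.

Import Order.TTheory GRing.Theory Num.Theory.
Local Open Scope ring_scope.
Local Open Scope quotient_scope.

(* Z_p is the inverse limit of the rings Z/p^n: an element is the sequence of
   its residues, the n-th one being represented in [0, p^n). The primality
   proof is a parameter of the type so that Q_p can be a fieldType. *)
Definition coherent (p : nat) (a : nat -> int) :=
  forall m n, (m <= n)%N -> (a n %% (p ^ m)%N%:Z)%Z = a m.

Record padic_int (p : nat) (p_pr : prime p) :=
  PadicInt { residue :> nat -> int; _ : `[< coherent p residue >] }.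

Section PadicInt.
Variables (p : nat) (p_pr : prime p).
Local Notation Zp := (padic_int p_pr).
Implicit Types a b c : Zp.

HB.instance Definition _ := gen_eqMixin Zp.
HB.instance Definition _ := gen_choiceMixin Zp.

Lemma padic_intP a m n : (m <= n)%N -> (a n %% (p ^ m)%N%:Z)%Z = a m.
Proof. by case: a => a /= /asboolP; apply. Qed.

Lemma padic_int_eq a b : (forall n, a n = b n) -> a = b.
Proof.
case: a b => [a pa] [b pb] /= eq_ab.
have e : a = b by apply/funext.
by subst b; congr PadicInt; apply: bool_irrelevance.
Qed.

Lemma dvdz_pexp m n : (m <= n)%N -> ((p ^ m)%N%:Z %| (p ^ n)%N%:Z)%Z.
Proof. by move=> mn; rewrite dvdzE /=; apply: dvdn_exp2l. Qed.

Lemma padic_int_of_subproof (f : nat -> int) :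
  (forall m n, (m <= n)%N -> (f n = f m %[mod (p ^ m)%N%:Z])%Z) ->
  `[< coherent p (fun n => (f n %% (p ^ n)%N%:Z)%Z) >].
Proof.
move=> fP; apply/asboolP => m n mn; rewrite -(fP m n mn).
have /dvdzP[q ->] := dvdz_pexp mn.
by rewrite [in RHS](divz_eq (f n) (q * (p ^ m)%N%:Z)) mulrA modzMDl.
Qed.

Definition padic_int_of f fP : Zp := PadicInt p_pr (@padic_int_of_subproof f fP).

Fact padic_cst_subproof (k : int) m n :
  (m <= n)%N -> (k = k %[mod (p ^ m)%N%:Z])%Z.
Proof. by []. Qed.

Fact padic_opp_subproof a m n :
  (m <= n)%N -> (- a n = - a m %[mod (p ^ m)%N%:Z])%Z.
Proof. by move=> mn; rewrite -(padic_intP a mn) modzNm. Qed.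

Fact padic_add_subproof a b m n :
  (m <= n)%N -> (a n + b n = a m + b m %[mod (p ^ m)%N%:Z])%Z.
Proof. by move=> mn; rewrite -(padic_intP a mn) -(padic_intP b mn) modzDm. Qed.

Fact padic_mul_subproof a b m n :
  (m <= n)%N -> (a n * b n = a m * b m %[mod (p ^ m)%N%:Z])%Z.
Proof. by move=> mn; rewrite -(padic_intP a mn) -(padic_intP b mn) modzMm. Qed.

Definition padic_cst k := padic_int_of (@padic_cst_subproof k).
Definition padic_opp a := padic_int_of (@padic_opp_subproof a).
Definition padic_add a b := padic_int_of (@padic_add_subproof a b).
Definition padic_mul a b := padic_int_of (@padic_mul_subproof a b).

Fact padic_addA : associative padic_add.
Proof. by move=> a b c; apply: padic_int_eq => n /=; rewrite modzDmr modzDml addrA. Qed.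

Fact padic_addC : commutative padic_add.
Proof. by move=> a b; apply: padic_int_eq => n /=; rewrite addrC. Qed.

Fact padic_add0 : left_id (padic_cst 0) padic_add.
Proof. by move=> a; apply: padic_int_eq => n /=; rewrite modzDml add0r padic_intP. Qed.

Fact padic_addN : left_inverse (padic_cst 0) padic_opp padic_add.
Proof. by move=> a; apply: padic_int_eq => n /=; rewrite modzDml addNr. Qed.

HB.instance Definition _ :=
  GRing.isZmodule.Build Zp padic_addA padic_addC padic_add0 padic_addN.

Fact padic_mulA : associative padic_mul.
Proof. by move=> a b c; apply: padic_int_eq => n /=; rewrite modzMmr modzMml mulrA. Qed.

Fact padic_mulC : commutative padic_mul.
Proof. by move=> a b; apply: padic_int_eq => n /=; rewrite mulrC. Qed.

Fact padic_mul1 : left_id (padic_cst 1) padic_mul.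
Proof. by move=> a; apply: padic_int_eq => n /=; rewrite modzMml mul1r padic_intP. Qed.

Fact padic_mulD : left_distributive padic_mul padic_add.
Proof.
by move=> a b c; apply: padic_int_eq => n /=; rewrite modzMml modzDm mulrDl.
Qed.

Fact padic_1_neq0 : padic_cst 1 != 0.
Proof.
apply/eqP => /(congr1 (fun a : Zp => a 1%N)) /=.
by rewrite expn1 mod0z modz_small //= ltz_nat prime_gt1.
Qed.

HB.instance Definition _ := GRing.Zmodule_isComNzRing.Build Zp
  padic_mulA padic_mulC padic_mul1 padic_mulD padic_1_neq0.

Definition padic_unit : {pred Zp} := fun a => `[< exists b, b * a = 1 >].
Definition padic_inv a : Zp :=
  if pselect (exists b, b * a = 1) is left ex then projT1 (cid ex) else a.

Fact padic_mulV : {in padic_unit, left_inverse 1 padic_inv *%R}.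
Proof.
move=> a /asboolP ex; rewrite /padic_inv; case: pselect => // ex'.
exact: projT2 (cid ex').
Qed.

Fact padic_unitP a b : b * a = 1 -> a \in padic_unit.
Proof. by move=> ba; apply/asboolP; exists b. Qed.

Fact padic_inv_out : {in [predC padic_unit], padic_inv =1 id}.
Proof.
move=> a /= /asboolPn nex; rewrite /padic_inv.
by case: pselect => // ex; case: nex.
Qed.

HB.instance Definition _ := GRing.ComNzRing_hasMulInverse.Build Zp
  padic_mulV padic_unitP padic_inv_out.

Fact padic_domain a b : a * b = 0 -> (a == 0) || (b == 0).
Proof.
move=> ab0; apply: contrapT => /negP; rewrite negb_or => /andP[a0 b0].
have nz c : c != 0 -> exists2 i, c i != 0 & forall n, (i <= n)%N ->
    ~~ ((p ^ i)%N%:Z %| c n)%Z.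
  move=> c0; have [i ci] : exists i, c i != 0.
    apply: contrapT => nex; case/eqP: c0; apply: padic_int_eq => n /=.
    rewrite mod0z; apply/eqP; apply: contrapT => /negP cn.
    by apply: nex; exists n.
  exists i => // n le_in; apply: contra ci => /dvdz_mod0P.
  by rewrite padic_intP // => ->.
have [i _ ai] := nz _ a0; have [j _ bj] := nz _ b0.
have le1 : (i <= i + j)%N by rewrite leq_addr.
have le2 : (j <= i + j)%N by rewrite leq_addl.
have := congr1 (fun c : Zp => c (i + j)%N) ab0; rewrite /= mod0z.
move/dvdz_mod0P; rewrite dvdzE /= abszM.
move: (ai _ le1) (bj _ le2); rewrite !dvdzE /=.
set x := absz _; set y := absz _ => nx ny.
have [x0|x0] := posnP x; first by rewrite x0 dvdn0 in nx.
have [y0|y0] := posnP y; first by rewrite y0 dvdn0 in ny.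
rewrite pfactor_dvdn // -ltnNge in nx; rewrite pfactor_dvdn // -ltnNge in ny.
rewrite pfactor_dvdn ?muln_gt0 ?x0 // lognM // leqNgt => /negP; apply.
by rewrite -addnS leq_add // ltnW.
Qed.

HB.instance Definition _ := GRing.ComUnitRing_isIntegral.Build Zp padic_domain.

Definition Qp := {fraction Zp}.
HB.instance Definition _ := GRing.Field.on Qp.

Definition padic_val (x : Qp) : int :=
  xget 0 [set k : int | exists2 u : Zp, u \is a GRing.unit
                                      & x = p%:R ^ k * FracField.tofrac u].

End PadicInt.

Section Valuation.
Variables (p : nat) (p_pr : prime p) (N : splittingFieldType (Qp p_pr)).
Implicit Types (E : {subfield N}) (x y l : N) (u : nat -> N).

Definition normQp x : Qp p_pr := xget 0 [set a | a%:A = galNorm 1 {:N} x].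

Lemma normQpE x : galois 1 {:N} -> (normQp x)%:A = galNorm 1 {:N} x.
Proof.
move=> galN; rewrite /normQp; case: xgetP => [a _ //|nex].
have /vlineP[a ea] := mem_galNorm galN (memvf x).
by case: (nex a); rewrite /= -ea.
Qed.

(* The unique valuation of N extending the one of Q_p (so that v(p) = 1); its
   restriction to a subfield E is the valuation of E. *)
Definition valN x : \bar rat :=
  if x == 0 then +oo%E
  else ((padic_val (normQp x))%:~R / (\dim {:N})%:R)%:E.

Definition valring E : set N := [set x | x \in E /\ (0 <= valN x)%E].

Definition uniformizer E pi :=
  [/\ pi \in E, pi != 0, (0 < valN pi)%E
    & forall x, x \in E -> (0 < valN x)%E -> (valN pi <= valN x)%E].

Definition cong_mod E pi x y := exists2 t, valring E t & x - y = pi * t.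

(* r is the reduction map O_E -> k, identifying O_E / pi O_E with k; its values
   outside O_E are irrelevant. *)
Definition residue_map E pi (k : fieldType) (r : N -> k) :=
  [/\ r 1 = 1,
      (forall x y, valring E x -> valring E y -> r (x + y) = r x + r y),
      (forall x y, valring E x -> valring E y -> r (x * y) = r x * r y),
      (forall c, exists2 x, valring E x & r x = c)
    & forall x, valring E x -> (r x = 0 <-> cong_mod E pi x 0)].

Definition frobenius_lift E pi (m : nat) (F : gal_of E) :=
  forall x, valring E x -> cong_mod E pi (F x) (x ^+ m).

Definition converges u l :=
  forall c : rat, exists n0, forall n, (n0 <= n)%N -> (c%:E <= valN (u n - l))%E.

(* padic_log (1 + x) as the sum of its series; 0 is a dummy value where it diverges. *)
Definition padic_log y : N :=
  let x := y - 1 in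
  xget 0 [set l | converges
    (fun n => \sum_(1 <= m < n.+1) (-1) ^+ m.-1 * x ^+ m / m%:R) l].

End Valuation.

Section GroupRing.
Variables (R : nzRingType) (gT : finGroupType).

Definition grmul (z w : {ffun gT -> R}) : {ffun gT -> R} :=
  [ffun g => \sum_h z h * w (h^-1 * g)%g].

Definition grone : {ffun gT -> R} := [ffun g => (g == 1%g)%:R].

Definition grmap (s : R -> R) (z : {ffun gT -> R}) : {ffun gT -> R} :=
  [ffun g => s (z g)].

Definition grunit (A : set R) (z : {ffun gT -> R}) :=
  (forall g, A (z g)) /\
  exists w : {ffun gT -> R},
    [/\ forall g, A (w g), grmul z w = grone & grmul w z = grone].

End GroupRing.

(* The group completion of a commutative monoid. *)
Section Completion.
Variable V : nmodType.
Implicit Types a b c : V * V.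

Definition compl_rel a b := `[< exists v, a.1 + b.2 + v = b.1 + a.2 + v >].

Fact compl_rel_refl : reflexive compl_rel.
Proof. by move=> a; apply/asboolP; exists 0. Qed.

Fact compl_rel_sym : symmetric compl_rel.
Proof. by move=> a b; apply/asboolP/asboolP => -[v e]; exists v. Qed.

Fact compl_rel_trans : transitive compl_rel.
Proof.
move=> b a c /asboolP[v e] /asboolP[w f]; apply/asboolP.
exists (b.1 + b.2 + v + w).
rewrite [LHS](AC (2*4) ((1*4*5)*(3*2*6))) /= e f.
by rewrite [LHS](AC (3*3) ((4*2)*(1*5*3*6))) /=.
Qed.

Canonical compl_equiv :=
  EquivRel compl_rel compl_rel_refl compl_rel_sym compl_rel_trans.

Definition completion := {eq_quot compl_rel}.
HB.instance Definition _ := Choice.on completion.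
HB.instance Definition _ := EqQuotient.on completion.

Lemma completion_eqP a b :
  \pi_completion a = \pi_completion b <->
  exists v, a.1 + b.2 + v = b.1 + a.2 + v.
Proof. by split=> [/eqmodP/asboolP | ex]; [| apply/eqmodP/asboolP]. Qed.

Implicit Types x y z : completion.

Definition compl_swap a : V * V := (a.2, a.1).
Definition compl_zero : completion := \pi_completion (0 : V * V).
Definition compl_opp x : completion := \pi_completion (compl_swap (generic_quotient.repr x)).
Definition compl_add x y : completion := \pi_completion (generic_quotient.repr x + generic_quotient.repr y : V * V).

Lemma compl_oppE a : compl_opp (\pi_completion a) = \pi_completion (compl_swap a).
Proof.
rewrite /compl_opp; apply/completion_eqP => /=.
have /completion_eqP[v e] : \pi_completion (generic_quotient.repr (\pi_completion a)) = \pi_completion a.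
  by rewrite reprK.
by exists v => /=; rewrite [X in X + v = _]addrC [X in _ = X + v]addrC.
Qed.

Lemma compl_addE a b : compl_add (\pi_completion a) (\pi_completion b) = \pi_completion (a + b : V * V).
Proof.
rewrite /compl_add; apply/completion_eqP => /=.
have /completion_eqP[v e] : \pi_completion (generic_quotient.repr (\pi_completion a)) = \pi_completion a.
  by rewrite reprK.
have /completion_eqP[w f] : \pi_completion (generic_quotient.repr (\pi_completion b)) = \pi_completion b.
  by rewrite reprK.
exists (v + w).
rewrite [LHS](AC (2*2*2) ((1*3*5)*(2*4*6))) /= e f.
by rewrite [LHS](AC (3*3) ((1*4)*(2*5)*(3*6))) /=.
Qed.

Lemma completionW (P : completion -> Prop) :
  (forall a, P (\pi_completion a)) -> forall x, P x.
Proof. by move=> Ppi x; rewrite -[x]reprK. Qed.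

Fact compl_addA : associative compl_add.
Proof.
elim/completionW => a; elim/completionW => b; elim/completionW => c.
rewrite (compl_addE b c) (compl_addE a (b + c)) (compl_addE a b).
by rewrite (compl_addE (a + b) c) addrA.
Qed.

Fact compl_addC : commutative compl_add.
Proof. by move=> x y; rewrite /compl_add addrC. Qed.

Fact compl_add0 : left_id compl_zero compl_add.
Proof. by elim/completionW => a; rewrite (compl_addE 0 a) add0r. Qed.

Fact compl_addN : left_inverse compl_zero compl_opp compl_add.
Proof.
elim/completionW => a; rewrite (compl_oppE a) (compl_addE (compl_swap a) a).
by apply/completion_eqP; exists 0 => /=; rewrite !addr0 add0r addrC.
Qed.

HB.instance Definition _ := GRing.isZmodule.Build completion
  compl_addA compl_addC compl_add0 compl_addN.

End Completion.

Section RepresentationRing.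
Variables (N : fieldType) (gT : finGroupType).
Local Notation rep := (representation N [set: gT]).
Implicit Types (T U : rep).

HB.instance Definition _ := gen_eqMixin rep.
HB.instance Definition _ := gen_choiceMixin rep.

Definition isorel T U := `[< mx_rsim T U >].

Fact isorel_refl : reflexive isorel.
Proof. by move=> T; apply/asboolP/mx_rsim_refl. Qed.

Fact isorel_sym : symmetric isorel.
Proof. by move=> T U; apply/asboolP/asboolP; apply: mx_rsim_sym. Qed.

Fact isorel_trans : transitive isorel.
Proof.
move=> T U W /asboolP TU /asboolP UW; apply/asboolP.
exact: mx_rsim_trans TU UW.
Qed.

Canonical iso_equiv := EquivRel isorel isorel_refl isorel_sym isorel_trans.

Definition isoclass := {eq_quot isorel}.
HB.instance Definition _ := Choice.on isoclass.
HB.instance Definition _ := EqQuotient.on isoclass.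

Lemma isoclass_eqP T U : \pi_isoclass T = \pi_isoclass U <-> mx_rsim T U.
Proof. by split=> [/eqmodP/asboolP | ex]; [| apply/eqmodP/asboolP]. Qed.

Lemma rsim_dadd T1 T2 U1 U2 : mx_rsim T1 U1 -> mx_rsim T2 U2 ->
  mx_rsim (dadd_grepr T1 T2) (dadd_grepr U1 U2).
Proof.
move=> [B1 n1 fB1 hB1] [B2 n2 fB2 hB2].
exists (block_mx B1 0 0 B2); first by rewrite /= n1 n2.
  have /row_freeP[C1 BC1] := fB1; have /row_freeP[C2 BC2] := fB2.
  apply/row_freeP; exists (block_mx C1 0 0 C2).
  by rewrite mulmx_block !(mulmx0, mul0mx, addr0, add0r) BC1 BC2 -scalar_mx_block.
move=> g Gg /=; rewrite !mulmx_block !(mulmx0, mul0mx, addr0, add0r).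
by rewrite hB1 // hB2.
Qed.

Lemma rsim_daddC T1 T2 : mx_rsim (dadd_grepr T1 T2) (dadd_grepr T2 T1).
Proof.
exists (block_mx 0 1%:M 1%:M 0); first by rewrite /= addnC.
  apply/row_freeP; exists (block_mx 0 1%:M 1%:M 0).
  by rewrite mulmx_block !(mulmx0, mul0mx, addr0, add0r, mulmx1) -scalar_mx_block.
move=> g Gg /=; rewrite !mulmx_block.
by rewrite !(mulmx0, mul0mx, addr0, add0r, mulmx1, mul1mx).
Qed.

Lemma rsim_dadd0 T : mx_rsim (dadd_grepr grepr0 T) T.
Proof.
exists (col_mx 0 1%:M) => //.
  apply/row_freeP; exists (row_mx 0 1%:M).
  rewrite mul_col_row !(mulmx0, mul0mx, mulmx1) [RHS]scalar_mx_block.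
  by congr block_mx; apply/matrixP => -[].
move=> g Gg /=; rewrite mul_block_col mul_col_mx.
by rewrite !(mulmx0, mul0mx, addr0, add0r, mulmx1, mul1mx).
Qed.

Lemma rsim_daddA T1 T2 T3 :
  mx_rsim (dadd_grepr T1 (dadd_grepr T2 T3)) (dadd_grepr (dadd_grepr T1 T2) T3).
Proof.
pose n1 := rdegree T1; pose n2 := rdegree T2; pose n3 := rdegree T3.
exists (col_mx (row_mx (row_mx 1%:M 0) 0)
  (col_mx (row_mx (row_mx 0 1%:M) 0) (row_mx (row_mx 0 0) 1%:M))).
- by rewrite /= addnA.
- apply/row_freeP; exists (col_mx
    (col_mx (row_mx 1%:M (row_mx 0 0)) (row_mx 0 (row_mx 1%:M 0)))
    (row_mx 0 (row_mx 0 1%:M))).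
  rewrite !(mul_col_mx, mul_row_col, mul_mx_row).
  rewrite !(mulmx0, mul0mx, mulmx1, mul1mx, row_mx0, addr0, add0r).
  rewrite -[X in col_mx _ X]/(block_mx 0 _ 0 _) block_mxEh col_mx0.
  by rewrite [RHS]scalar_mx_block (@scalar_mx_block _ n2 n3).
move=> g Gg /=; rewrite /block_mx !(mul_col_mx, mul_row_col, mul_mx_row).
by rewrite !(mulmx0, mul0mx, mulmx1, mul1mx, row_mx0, addr0, add0r).
Qed.

Implicit Types x y z : isoclass.

Definition iso_zero : isoclass := \pi_isoclass grepr0.
Definition iso_add x y : isoclass :=
  \pi_isoclass (dadd_grepr (generic_quotient.repr x) (generic_quotient.repr y)).

Lemma rsim_repr T : mx_rsim (generic_quotient.repr (\pi_isoclass T)) T.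
Proof. by apply/isoclass_eqP; rewrite reprK. Qed.

Lemma iso_addE T U :
  iso_add (\pi_isoclass T) (\pi_isoclass U) = \pi_isoclass (dadd_grepr T U).
Proof. by apply/isoclass_eqP/rsim_dadd; apply: rsim_repr. Qed.

Lemma isoclassW (P : isoclass -> Prop) :
  (forall T, P (\pi_isoclass T)) -> forall x, P x.
Proof. by move=> Ppi x; rewrite -[x]reprK. Qed.

Fact iso_addA : associative iso_add.
Proof.
elim/isoclassW => T1; elim/isoclassW => T2; elim/isoclassW => T3.
rewrite (iso_addE T2 T3) (iso_addE T1 (dadd_grepr T2 T3)) (iso_addE T1 T2).
by rewrite (iso_addE (dadd_grepr T1 T2) T3); apply/isoclass_eqP/rsim_daddA.
Qed.

Fact iso_addC : commutative iso_add.
Proof. by move=> x y; apply/isoclass_eqP/rsim_daddC. Qed.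

Fact iso_add0 : left_id iso_zero iso_add.
Proof.
elim/isoclassW => T; rewrite (iso_addE grepr0 T).
exact/isoclass_eqP/rsim_dadd0.
Qed.

HB.instance Definition _ :=
  GRing.isNmodule.Build isoclass iso_addA iso_addC iso_add0.

(* R(G) = K_0(N[G]): formal differences of isomorphism classes of finite
   dimensional representations of G over N. *)
Definition repring := completion isoclass.

Definition mkvirtual T U : repring :=
  \pi_(completion isoclass) (\pi_isoclass T, \pi_isoclass U).

(* Representations T, U such that X = [T] - [U]. *)
Definition virtual_repr (X : repring) : rep * rep :=
  let a := generic_quotient.repr X in
  (generic_quotient.repr a.1, generic_quotient.repr a.2).

Lemma virtual_reprK X : mkvirtual (virtual_repr X).1 (virtual_repr X).2 = X.
Proof. by rewrite /mkvirtual /= !reprK -surjective_pairing reprK. Qed.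

Lemma mkvirtual_eqP T U T' U' : mkvirtual T U = mkvirtual T' U' <->
  exists W, mx_rsim (dadd_grepr (dadd_grepr T U') W)
                    (dadd_grepr (dadd_grepr T' U) W).
Proof.
have addE A B C : \pi_isoclass A + \pi_isoclass B + \pi_isoclass C
    = \pi_isoclass (dadd_grepr (dadd_grepr A B) C) :> isoclass.
  by rewrite -[LHS]/(iso_add (iso_add _ _) _) (iso_addE A B) (iso_addE _ C).
split=> [/completion_eqP[w /= e] | [W e]].
  exists (generic_quotient.repr w).
  apply/(isoclass_eqP (dadd_grepr (dadd_grepr _ _) _)
                      (dadd_grepr (dadd_grepr _ _) _)).
  by rewrite -!addE reprK.
apply/completion_eqP; exists (\pi_isoclass W); rewrite /= !addE.
exact/isoclass_eqP.
Qed.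

(* Elements of R(G) are handled through the representatives [virtual_repr];
   the lemmas [virtual_char_mk], [galaction_mk] and [Det_mk] state that the result
   does not depend on them. *)
Definition virtual_char (X : repring) (g : gT) : N :=
  \tr ((virtual_repr X).1 g) - \tr ((virtual_repr X).2 g).

Lemma rsim_mxtrace T U g : mx_rsim T U -> \tr (T g) = \tr (U g).
Proof.
case/mx_rsim_def => B [B' BB' ->]; last by rewrite inE.
by rewrite mxtrace_mulC mulmxA BB' mul1mx.
Qed.

Lemma virtual_char_mk T U g : virtual_char (mkvirtual T U) g = \tr (T g) - \tr (U g).
Proof.
rewrite /virtual_char; set TU := virtual_repr _.
have [W /(@rsim_mxtrace _ _ g)] := (mkvirtual_eqP _ _ _ _).1 (virtual_reprK (mkvirtual T U)).
rewrite -/TU /= !mxtrace_block => /addIr e.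
by apply/eqP; rewrite subr_eq addrAC eq_sym subr_eq e.
Qed.

(* psi^m, defined through characters by chi_(psi^m X) (g) = chi_X (g ^ m). In
   characteristic 0 there is exactly one such element of R(G), so that the
   default value 0 is not used. *)
Definition adams (m : nat) (X : repring) : repring :=
  xget 0 [set Y | forall g, virtual_char Y g = virtual_char X (g ^+ m)%g].

Definition galrepr (s : {rmorphism N -> N}) T : rep :=
  Representation (map_repr s T).

Definition galaction (s : {rmorphism N -> N}) (X : repring) : repring :=
  mkvirtual (galrepr s (virtual_repr X).1) (galrepr s (virtual_repr X).2).

Lemma galaction_mk s T U :
  galaction s (mkvirtual T U) = mkvirtual (galrepr s T) (galrepr s U).
Proof.
rewrite /galaction; set TU := virtual_repr _.
have [W TUW] := (mkvirtual_eqP _ _ _ _).1 (virtual_reprK (mkvirtual T U)).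
apply/mkvirtual_eqP; exists (galrepr s W); move: TUW; rewrite -/TU => TUW.
have daddE A B C : mx_rsim (galrepr s (dadd_grepr (dadd_grepr A B) C))
    (dadd_grepr (dadd_grepr (galrepr s A) (galrepr s B)) (galrepr s C)).
  exists 1%:M => //; first by rewrite row_free_unit unitmx1.
  move=> g _; rewrite mulmx1 mul1mx /= /map_repr_mx /= !map_block_mx.
  by rewrite !map_mx0.
apply: mx_rsim_trans (mx_rsim_sym (daddE _ _ _)) _.
apply: mx_rsim_trans (daddE _ _ _).
exact: mx_rsim_map.
Qed.

Definition evalrep (z : {ffun gT -> N}) T : 'M[N]_(rdegree T) :=
  \sum_g z g *: T g.

Definition Det (z : {ffun gT -> N}) (X : repring) : N :=
  \det (evalrep z (virtual_repr X).1) / \det (evalrep z (virtual_repr X).2).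

Lemma rsim_det (z : {ffun gT -> N}) T U : mx_rsim T U -> \det (evalrep z T) = \det (evalrep z U).
Proof.
case: T U => [m T] [n U] [B /= e]; move: T U B; rewrite e => T U B.
rewrite row_free_unit => uB hB.
have TB : evalrep z (Representation T) *m B = B *m evalrep z (Representation U).
  rewrite /evalrep mulmx_suml mulmx_sumr; apply: eq_bigr => g _ /=.
  by rewrite -scalemxAl -scalemxAr hB.
have := congr1 (fun A => \det A) TB; rewrite !det_mulmx mulrC.
by apply/mulfI; rewrite -unitfE -unitmxE.
Qed.

Lemma det_dadd (z : {ffun gT -> N}) T U : \det (evalrep z (dadd_grepr T U))
  = \det (evalrep z T) * \det (evalrep z U).
Proof.
suff -> : evalrep z (dadd_grepr T U) = block_mx (evalrep z T) 0 0 (evalrep z U).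
  by rewrite det_ublock.
rewrite /evalrep; elim/big_rec3: _ => [|g A B C _ ->].
  by rewrite -[RHS]/(block_mx 0 0 0 0) block_mx0.
by rewrite scale_block_mx add_block_mx !scaler0 !addr0.
Qed.

Lemma evalrep_mul (z w : {ffun gT -> N}) T :
  evalrep (grmul z w) T = evalrep z T *m evalrep w T.
Proof.
rewrite /evalrep mulmx_suml.
under eq_bigr do rewrite ffunE scaler_suml.
rewrite exchange_big; apply: eq_bigr => h _ /=.
rewrite (reindex_inj (mulgI h)) mulmx_sumr; apply: eq_bigr => g _.
by rewrite mulKg repr_mxM ?inE // -scalemxAl -scalemxAr scalerA.
Qed.

Lemma evalrep1 T : evalrep (grone N gT) T = 1%:M.
Proof.
rewrite /evalrep (bigD1 1%g) //= ffunE eqxx scale1r repr_mx1 big1 ?addr0 //.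
by move=> g /negPf g1; rewrite ffunE g1 scale0r.
Qed.

Lemma Det_mk A (z : {ffun gT -> N}) T U : grunit A z ->
  Det z (mkvirtual T U) = \det (evalrep z T) / \det (evalrep z U).
Proof.
case=> _ [w [_ zw _]].
have nz W : \det (evalrep z W) != 0.
  have := congr1 (fun B => \det (evalrep B W)) zw.
  rewrite evalrep_mul evalrep1 det1 det_mulmx => e.
  by apply/eqP => z0; move/eqP: e; rewrite z0 mul0r eq_sym oner_eq0.
rewrite /Det; set TU := virtual_repr _.
have [W /(rsim_det z)] := (mkvirtual_eqP _ _ _ _).1 (virtual_reprK (mkvirtual T U)).
rewrite -/TU !det_dadd => /(mulIf (nz _)) e.
by apply/eqP; rewrite eqr_div // e.
Qed.

End RepresentationRing.

Section Log.
Variables (p : nat) (p_pr : prime p) (N : splittingFieldType (Qp p_pr)).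
Implicit Types M : {subfield N}.

(* The composite sigma o F o sigma^-1: products in gal_of M are composed from
   left to right. *)
Definition galconj M (sigma F : gal_of M) : gal_of M := (sigma^-1 * F * sigma)%g.

Lemma galconjE M (sigma F : gal_of M) x :
  x \in M -> galconj sigma F x = sigma (F ((sigma^-1)%g x)).
Proof. by move=> Mx; rewrite /galconj !galM // !memv_gal. Qed.

Variable gT : finGroupType.

(* m is the order p^q of the residue field of K. *)
Definition LogF M (m : nat) (F : gal_of M)
    (z : {ffun gT -> N}) (X : repring N gT) : N :=
  padic_log (Det (grmap F z) (adams m X) / Det z X ^+ m).

(* The action of s on functions R(G) -> N, (s . f)(T) = s (f (s^-1 T)). *)
Definition homaction (s : gal_of {:N}) (f : repring N gT -> N)
    (X : repring N gT) : N :=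
  s (f (galaction (s^-1 : gal_of {:N})%g X)).

End Log.

(* Main.v *)
Require Import Defs.
From mathcomp Require Import all_boot all_order all_fingroup all_algebra.
From mathcomp Require Import all_solvable all_field all_character.
From mathcomp Require Import boolp classical_sets constructive_ereal filter zify.

(* An automorphism s of N preserves norms down to Q_p, hence valuations, so it
   commutes with congruences and with limits; and Det, being given by
   determinants, satisfies Det (s z) X = s (Det z (s^-1 X)). Two points need an
   argument.
   - The logarithm is picked among the limits of its series, so limits must be
     shown unique. Instead of the ultrametric inequality on N, it is enough that
     a vector of small norm has small coordinates over Q_p: otherwise, rescaling
     by the largest coordinate and using the compactness of Z_p, one gets a
     nonzero vector of norm 0.
   - The Adams operation picks an element of R(G) with a given character, so Det z
     must be shown to depend on the character only: the character gives the traces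
     of all the powers of T(z), and these determine det T(z) in characteristic 0
     by Newton's identities. *)

Set Implicit Arguments.
Unset Strict Implicit.
Unset Printing Implicit Defensive.

Import Order.TTheory GRing.Theory Num.Theory.
Local Open Scope ring_scope.

(** * Newton identities *)

Lemma deriv_prod (R : comNzRingType) (I : finType) (P : pred I) (f : I -> {poly R}) :
  (\prod_(i | P i) f i)^`() = \sum_(i | P i) (f i)^`() * \prod_(j | P j && (j != i)) f j.
Proof.
elim: {P}_.+1 {-2}P (ltnSn #|P|) => // n IHn P; rewrite ltnS => leP.
case: (pickP P) => [i Pi | P0]; last by rewrite !big_pred0 // derivC.
rewrite (bigD1 i) //= [RHS](bigD1 i) //= derivM IHn; last first.
  apply: leq_trans leP; apply: proper_card; apply/properP; split.
    by apply/fintype.subsetP => j /andP[].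
  by exists i; rewrite // unfold_in /= eqxx andbF.
congr (_ + _); rewrite mulr_sumr; apply: eq_bigr => j /andP[Pj ji].
rewrite mulrCA [in RHS](bigD1 i) ?Pi 1?eq_sym //=; congr (_ * (_ * _)).
by apply: eq_bigl => k; rewrite -!andbA [(k != i) && _]andbC.
Qed.

(** Jacobi's formula: [B i] is [A] with row [i] differentiated, and expanding [\det (B i)] along
    that row brings out the cofactors of [A]. *)
Lemma deriv_det (R : comNzRingType) n (A : 'M[{poly R}]_n) :
  (\det A)^`() = \tr (\adj A *m map_mx (@deriv R) A).
Proof.
pose B i := \matrix_(k, l) (if k == i then (A k l)^`() else A k l).
transitivity (\sum_i \det (B i)).
  rewrite raddf_sum exchange_big; apply: eq_bigr => s _ /=.
  rewrite -mulr_sumr -signr_odd mulr_sign -[in RHS]signr_odd mulr_sign.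
  have -> : (\sum_i \prod_j B i j (s j)) = (\prod_i A i (s i))^`().
    rewrite deriv_prod; apply: eq_bigr => i _; rewrite (bigD1 i) //= mxE eqxx.
    by congr (_ * _); apply: eq_bigr => j /negPf ji; rewrite mxE ji.
  by case: ifP => // _; rewrite derivN.
rewrite mxtrace_mulC; apply: eq_bigr => i _.
rewrite (expand_det_row _ i) mxE; apply: eq_bigr => j _; rewrite !mxE eqxx.
congr (_ * (_ * \det _)); apply/matrixP => k l; rewrite !mxE.
by rewrite eq_sym (negPf (neq_lift _ _)).
Qed.

Lemma tr_adj_char_poly_mx (R : comNzRingType) n (A : 'M[R]_n) :
  \tr (\adj (char_poly_mx A)) = (char_poly A)^`().
Proof.
rewrite deriv_det; congr (\tr _); rewrite -[LHS]mulmx1; congr (_ *m _).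
apply/matrixP => i j; rewrite !mxE derivB derivC subr0 derivMn derivX.
by case: eqP.
Qed.

(** The adjugate of [X - A] is read as a polynomial with matrix coefficients; multiplying it by
    [X - A] and comparing coefficients gives a descending recursion on them. *)
Definition adj_coef (R : comNzRingType) n (A : 'M[R]_n) k : 'M[R]_n :=
  map_mx (coefp k) (\adj (char_poly_mx A)).

Lemma coef_mul_adj (R : comNzRingType) n (A : 'M[R]_n) k :
  (if k == 0 then 0 else adj_coef A k.-1)
    = A *m adj_coef A k + ((char_poly A)`_k)%:M.
Proof.
have e : 'X *: \adj (char_poly_mx A)
    = map_mx polyC A *m \adj (char_poly_mx A) + (char_poly A)%:M.
  by rewrite -mul_mx_adj mulmxBl mul_scalar_mx addrC subrK.
move: e; rewrite /adj_coef; move: (\adj _) => Q e; apply/matrixP => i j.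
have := congr1 (fun B : 'M[{poly R}]_n => coefp k (B i j)) e.
rewrite !mxE /= coefXM coefD coefMn coef_sum => e'.
transitivity ((if k == 0 then 0 else (Q i j)`_k.-1) : R).
  by case: (k == 0%N); rewrite mxE.
rewrite e'; congr (_ + _).
by apply: eq_bigr => l _; rewrite !mxE coefCM.
Qed.

Lemma adj_coefS (R : comNzRingType) n (A : 'M[R]_n) k :
  adj_coef A k = A *m adj_coef A k.+1 + ((char_poly A)`_k.+1)%:M.
Proof. exact: coef_mul_adj A k.+1. Qed.

Lemma tr_adj_coef (R : comNzRingType) n (A : 'M[R]_n) k :
  \tr (adj_coef A k) = (char_poly A)`_k.+1 *+ k.+1.
Proof.
rewrite -coef_deriv -tr_adj_char_poly_mx coef_sum.
by apply: eq_bigr => i _; rewrite mxE.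
Qed.

(** By [adj_coefS], [adj_coef A k] is a polynomial in [A] whose coefficients are those of
    [char_poly A] of index above [k], so the left side is a combination of power sums. *)
Lemma newton_identity (R : comNzRingType) n (A : 'M[R]_n) k :
  \tr (A *m adj_coef A k) = (char_poly A)`_k *+ k - (char_poly A)`_k *+ n.
Proof.
apply/eqP; rewrite eq_sym subr_eq -(mxtrace_scalar n) -mxtraceD -coef_mul_adj.
by case: k => [|k]; rewrite ?mulr0n ?mxtrace0 //= tr_adj_coef.
Qed.

Lemma adj_coef_eq0 (R : comNzRingType) n (A : 'M[R]_n) :
  exists K, forall k, (K <= k)%N -> adj_coef A k = 0.
Proof.
exists (\max_(ij : 'I_n * 'I_n) size (\adj (char_poly_mx A) ij.1 ij.2)) => k leKk.
apply/matrixP => i j; rewrite mxE [RHS]mxE; apply: nth_default.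
by apply: leq_trans leKk; apply: (leq_bigmax (i, j)).
Qed.

(* Newton's identities determine the coefficients of the characteristic
   polynomial, from the leading one downwards. *)
Lemma char_poly_eq_tr (F : fieldType) n (A B : 'M[F]_n) : [pchar F] =i pred0 ->
  (forall k, \tr (A ^+ k) = \tr (B ^+ k)) -> char_poly A = char_poly B.
Proof.
move=> F0 trAB; have [KA A0] := adj_coef_eq0 A; have [KB B0] := adj_coef_eq0 B.
(* Downward induction on [k], started where all terms vanish. Newton's identity uses only [m = 1],
   but the recursion [trS] raises [m], so all powers are carried along. *)
suff coefAB d k : (maxn n.+1 (maxn KA KB) <= k + d)%N ->
    (char_poly A)`_k = (char_poly B)`_k /\
    forall m, \tr (A ^+ m *m adj_coef A k) = \tr (B ^+ m *m adj_coef B k).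
  by apply/polyP => k; have [] := coefAB _ k (leq_addl _ _).
elim: d k => [|d IHd] k; last rewrite -addSnnS => /IHd[cS tS].
  rewrite addn0 !geq_max => /and3P[nk KAk KBk]; split=> [|m].
    by rewrite !nth_default ?size_char_poly.
  by rewrite A0 // B0 // !mulmx0.
have trS m (C : 'M[F]_n) : \tr (C ^+ m *m adj_coef C k)
    = \tr (C ^+ m.+1 *m adj_coef C k.+1) + (char_poly C)`_k.+1 * \tr (C ^+ m).
  rewrite adj_coefS mulmxDr mxtraceD mulmxA exprSr; congr (_ + _).
  by rewrite mul_mx_scalar mxtraceZ.
have trk m : \tr (A ^+ m *m adj_coef A k) = \tr (B ^+ m *m adj_coef B k).
  apply: etrans (trS m A) (etrans _ (esym (trS m B))).
  exact: f_equal2 (tS m.+1) (f_equal2 _ cS (trAB m)).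
split=> [|m]; last exact: trk.
have [nk|nk] := ltnP n k; first by rewrite !nth_default ?size_char_poly.
(* At [k = n] the factor [n - k] of Newton's identity is 0, but both polynomials are monic of degree
   [n]. *)
have [->|kn] := eqVneq k n.
  move: (monicP (char_poly_monic A)) (monicP (char_poly_monic B)).
  by rewrite !lead_coefE !size_char_poly => -> ->.
have {nk kn} ltkn : (k < n)%N by rewrite ltn_neqAle kn.
have trAdj (C : 'M[F]_n) : \tr (C ^+ 1 *m adj_coef C k) = - ((char_poly C)`_k * (n - k)%:R).
  rewrite expr1 newton_identity mulr_natr -opprB mulrnBr //.
  exact: ltnW.
have /oppr_inj/mulIf := etrans (esym (trAdj A)) (etrans (trk 1%N) (trAdj B)).
apply.
by rewrite ((pcharf0P F).1 F0) -lt0n subn_gt0.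
Qed.

(** * Determinants and Adams operations *)

Lemma rdegree_eq_tr (F : fieldType) (gT : finGroupType)
    (T U : representation F [set: gT]) : [pchar F] =i pred0 ->
  \tr (T 1%g) = \tr (U 1%g) -> rdegree T = rdegree U.
Proof.
move=> F0; rewrite !repr_mx1 !mxtrace1 => /eqP.
wlog leTU : T U / (rdegree T <= rdegree U)%N.
  move=> wl; have [|/ltnW] := leqP (rdegree T) (rdegree U); first exact: wl.
  by move=> le; rewrite eq_sym => /(wl _ _ le).
rewrite eq_sym -subr_eq0 -natrB // ((pcharf0P F).1 F0) subn_eq0 => leUT.
by apply/eqP; rewrite eqn_leq leTU.
Qed.

(** The witness is the [k]-th power of [z] in the group ring, the same for every [T]; hence traces
    of powers are combinations of character values with coefficients independent of [T]. *)
Lemma evalrepX (F : fieldType) (gT : finGroupType) (z : {ffun gT -> F}) k :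
  exists w, forall T : representation F [set: gT],
    evalrep z T ^+ k = evalrep w T.
Proof.
elim: k => [|k [w IHk]]; first by exists (grone F gT) => T; rewrite evalrep1.
by exists (grmul z w) => T; rewrite exprS IHk evalrep_mul.
Qed.

Lemma det_evalrep_eq_tr (F : fieldType) (gT : finGroupType) (z : {ffun gT -> F})
    (T U : representation F [set: gT]) : [pchar F] =i pred0 ->
  (forall g, \tr (T g) = \tr (U g)) -> \det (evalrep z T) = \det (evalrep z U).
Proof.
move=> F0 trTU.
have trX k : \tr (evalrep z T ^+ k) = \tr (evalrep z U ^+ k).
  have [w zw] := evalrepX z k; rewrite !zw /evalrep !raddf_sum.
  by apply: eq_bigr => g _; rewrite /= !mxtraceZ trTU.
have := rdegree_eq_tr F0 (trTU 1%g).
move: (evalrep z T) (evalrep z U) trX; move: (rdegree T) (rdegree U) => m n A B.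
move=> trX emn; case: n / emn B trX => B trX.
have := congr1 (fun p : {poly F} => p`_0) (char_poly_eq_tr F0 trX).
by rewrite !char_poly_det => /(mulfI (negbT (signr_eq0 _ _))).
Qed.

Lemma det_evalrep_neq0 (F : fieldType) (gT : finGroupType) A
    (z : {ffun gT -> F}) (T : representation F [set: gT]) :
  grunit A z -> \det (evalrep z T) != 0.
Proof.
case=> _ [w [_ zw _]]; apply/eqP => z0.
have := congr1 (fun v => \det (evalrep v T)) zw.
by rewrite evalrep_mul evalrep1 det1 det_mulmx z0 mul0r => /eqP; rewrite eq_sym oner_eq0.
Qed.

(** Cross-multiplying the two quotients leaves determinants of direct sums, which are genuine
    representations with the same character. *)
Lemma eq_virtual_char_Det (F : fieldType) (gT : finGroupType) A
    (z : {ffun gT -> F}) (X Y : repring F gT) : [pchar F] =i pred0 ->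
  grunit A z -> virtual_char X =1 virtual_char Y -> Det z X = Det z Y.
Proof.
move=> F0 uz eXY; rewrite /Det; apply/eqP; rewrite eqr_div ?(det_evalrep_neq0 _ uz) //.
rewrite -!det_dadd; apply/eqP/det_evalrep_eq_tr => // g; rewrite /= !mxtrace_block.
have /eqP := eXY g.
by rewrite /virtual_char subr_eq addrAC eq_sym subr_eq eq_sym => /eqP.
Qed.

(** * Galois action on characters, Adams operations and determinants *)

Lemma virtual_char_galaction (F : fieldType) (gT : finGroupType)
    (s : {rmorphism F -> F}) (X : repring F gT) g :
  virtual_char (galaction s X) g = s (virtual_char X g).
Proof.
rewrite virtual_char_mk [in RHS]/virtual_char rmorphB /=.
by rewrite /map_repr_mx !trace_map_mx.
Qed.

Lemma virtual_char0 (F : fieldType) (gT : finGroupType) g :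
  virtual_char (0 : repring F gT) g = 0.
Proof. by rewrite -[0]/(mkvirtual grepr0 grepr0) virtual_char_mk subrr. Qed.

Section GaloisEquivariance.
Variables (F : fieldType) (gT : finGroupType) (s t : {rmorphism F -> F}).
Hypothesis tK : cancel t s.
Implicit Types (X : repring F gT) (z : {ffun gT -> F}).

(* The existence of Adams operations plays no role: if no element of R(G) has
   the required character, both [adams m X] and [adams m (t . X)] are 0. *)
Lemma virtual_char_adams_galaction m X :
  virtual_char (adams m (galaction t X)) =1 virtual_char (galaction t (adams m X)).
Proof.
move=> g; rewrite virtual_char_galaction /adams.
case: xgetP => [Y _ /= eY|nY]; case: xgetP => [Z _ /= eZ|nZ].
- by rewrite eY eZ virtual_char_galaction.
- case: (nZ (galaction s Y)) => h /=.
  by rewrite virtual_char_galaction eY virtual_char_galaction tK.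
- case: (nY (galaction t Z)) => h /=.
  by rewrite !virtual_char_galaction eZ.
by rewrite !virtual_char0 rmorph0.
Qed.

Lemma grunit_map A z : grunit A z -> grunit [set: F] (grmap s z).
Proof.
have grmapM u v : grmul (grmap s u) (grmap s v) = grmap s (grmul u v).
  apply/ffunP => g; rewrite !ffunE rmorph_sum; apply: eq_bigr => h _.
  by rewrite !ffunE rmorphM.
case=> _ [w [_ zw wz]]; split=> //; exists (grmap s w); split=> //;
  rewrite grmapM (zw, wz); apply/ffunP => g; rewrite !ffunE; exact: rmorph_nat.
Qed.

(** Each [T] is the image under [s] of its conjugate by [t], and [s] commutes with determinants;
    [Det_mk] allows computing with the conjugated representatives. *)
Lemma Det_grmap z X A : grunit A z ->
  Det (grmap s z) X = s (Det z (galaction t X)).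
Proof.
move=> uz; rewrite (Det_mk _ _ uz) fmorph_div /Det.
suff det_grmap T : \det (evalrep (grmap s z) T) = s (\det (evalrep z (galrepr t T))).
  by rewrite !det_grmap.
rewrite -det_map_mx; congr (\det _); rewrite /evalrep map_mx_sum.
apply: eq_bigr => g _; rewrite map_mxZ ffunE /= /map_repr_mx; congr (_ *: _).
by apply/matrixP => i j; rewrite !mxE tK.
Qed.

Lemma Det_grmap_adams m z X A : [pchar F] =i pred0 -> grunit A z ->
  Det (grmap s z) (adams m X) = s (Det z (adams m (galaction t X))).
Proof.
move=> F0 uz; rewrite (Det_grmap _ uz); congr (s _).
by apply: eq_virtual_char_Det uz _ => // g; rewrite virtual_char_adams_galaction.
Qed.

End GaloisEquivariance.

(** * The filtration of Q_p by powers of p *)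

Lemma fraction_quot (R : idomainType) (x : {fraction R}) :
  exists a b : R, b != 0 /\ x = FracField.tofrac a / FracField.tofrac b.
Proof.
elim/quotW: x => x; exists \n_x, \d_x; split; first exact: denom_ratioP.
apply/(canRL (mulfK _)); first by rewrite tofrac_eq0 denom_ratioP.
rewrite -[LHS]/(FracField.mul _ _) !piE; apply/eqmodP.
rewrite /= FracField.equivfE /FracField.mulf !numden_Ratio ?mulr1 ?oner_eq0 ?denom_ratioP //.
by rewrite mulrC.
Qed.

Section PadicNumbers.
Variables (p : nat) (p_pr : prime p).
Local Notation Zp := (padic_int p_pr).
Local Notation Qp := (Qp p_pr).
Local Notation frac := (@FracField.tofrac Zp).
Implicit Types (a b u : Zp) (x y : Qp).

Let pX_gt0 n : 0 < (p ^ n)%N%:Z.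
Proof. by rewrite ltz_nat expn_gt0 prime_gt0. Qed.
Let pX_neq0 n : (p ^ n)%N%:Z != 0.
Proof. by rewrite gt_eqF. Qed.

Lemma residue_mod a n : (a n %% (p ^ n)%N%:Z)%Z = a n.
Proof. exact: padic_intP. Qed.

Lemma residue_ge0 a n : 0 <= a n.
Proof. by rewrite -residue_mod modz_ge0. Qed.

Lemma residue_lt a n : a n < (p ^ n)%N%:Z.
Proof. by rewrite -residue_mod -{2}[_%:Z]gez0_abs ?ltz_mod // ltW. Qed.

Lemma residue_natr m n : (m%:R : Zp) n = (m%:Z %% (p ^ n)%N%:Z)%Z.
Proof.
elim: m => [|m IHm] //; rewrite -natr1.
rewrite -[LHS]/(((m%:R : Zp) n + (1 %% _)%Z) %% _)%Z IHm modzDm.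
by rewrite -addn1 PoszD.
Qed.

Lemma dvdz_residue a j n : a j = 0 -> (j <= n)%N -> ((p ^ j)%N%:Z %| a n)%Z.
Proof. by move=> aj jn; apply/dvdz_mod0P; rewrite padic_intP. Qed.

Lemma residue_eq0 a j : a j = 0 -> exists b, a = p%:R ^+ j * b.
Proof.
(* Dividing by [p ^ j] costs [j] digits of precision, hence the shift of the index. *)
move=> aj; pose f n := (a (n + j)%N %/ (p ^ j)%N%:Z)%Z.
have fE n : a (n + j)%N = f n * (p ^ j)%N%:Z.
  by rewrite divzK // dvdz_residue ?leq_addl.
have fP m n : (m <= n)%N -> (f n = f m %[mod (p ^ m)%N%:Z])%Z.
  move=> mn; apply/eqP; rewrite eqz_mod_dvd -(dvdz_mul2r (pX_neq0 j)).
  rewrite mulrBl -!fE -PoszM -expnD -eqz_mod_dvd; apply/eqP.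
  by rewrite residue_mod padic_intP // leq_add2r.
exists (padic_int_of p_pr fP); rewrite -natrX; apply: padic_int_eq => n.
rewrite -[RHS]/(((p ^ j)%N%:R : Zp) n * (f n %% _)%Z %% _)%Z residue_natr modzMm.
by rewrite mulrC -fE padic_intP ?leq_addr.
Qed.

(** Bezout coefficients invert [a] modulo each [p ^ n]; they are coherent because inverses modulo
    [p ^ m] are unique. *)
Lemma residue1_unit a : a 1%N != 0 -> a \is a GRing.unit.
Proof.
move=> a1; pose f n := (egcdz (a n) (p ^ n)%N%:Z).1.
have fE n : (f n * a n = 1 %[mod (p ^ n)%N%:Z])%Z.
  case: n => [|n]; first by rewrite expn0 !modz1.
  rewrite /f; case: egcdzP => u v /= e _.
  have g1 : gcdz (a n.+1) (p ^ n.+1)%N%:Z = 1.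
    apply/eqP; rewrite -[_ == 1]/(coprimez _ _) coprimezE /= coprime_sym.
    rewrite coprimeXl // prime_coprime //; apply: contra a1 => pa.
    have /dvdz_mod0P : ((p ^ 1)%N%:Z %| a n.+1)%Z by rewrite expn1.
    by rewrite padic_intP // => ->.
  by rewrite -g1 -e addrC modzMDl.
have fP m n : (m <= n)%N -> (f n = f m %[mod (p ^ m)%N%:Z])%Z.
  move=> mn.
  have fnm : (f n * a m = 1 %[mod (p ^ m)%N%:Z])%Z.
    rewrite -(padic_intP a mn) modzMmr; apply/eqP; rewrite eqz_mod_dvd.
    apply: dvdz_trans (dvdz_pexp p mn) _; rewrite -eqz_mod_dvd; apply/eqP/fE.
  rewrite -[f n]mulr1 -modzMmr -fE modzMmr mulrCA -modzMmr fnm modzMmr mulr1 //.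
rewrite unfold_in; apply/asboolP; exists (padic_int_of p_pr fP).
apply: padic_int_eq => n.
by rewrite -[LHS]/((f n %% _)%Z * a n %% _)%Z modzMml fE.
Qed.

Lemma unit_residue1 a : a \is a GRing.unit -> a 1%N != 0.
Proof.
move=> ua; apply/eqP => a1; have := congr1 (fun b : Zp => b 1%N) (mulVr ua).
rewrite -[LHS]/(_ * a 1%N %% _)%Z a1 mulr0 mod0z.
by rewrite -[RHS]/(1 %% _)%Z expn1 modz_small ?ltz_nat ?prime_gt1.
Qed.

Lemma padic_factor a : a != 0 -> exists j u, u \is a GRing.unit /\ a = p%:R ^+ j * u.
Proof.
move=> a0; have [i ai] : exists i, a i != 0.
  apply: contrapT => nex; case/eqP: a0; apply: padic_int_eq => n.
  by rewrite [RHS]mod0z; apply/eqP; apply: contrapT => /negP an; apply: nex; exists n.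
(* The exponent is the least such [j]: then [p ^ j] divides [a], and a cofactor divisible by [p]
   would force [a j.+1] to vanish. *)
have exj : exists j, a j.+1 != 0.
  exists i; apply: contra ai => /eqP ai.
  by rewrite -(padic_intP a (leqnSn i)) ai mod0z.
case: (ex_minnP exj) => j aj minj.
have aj0 : a j = 0.
  case: j minj {aj} => [|j] minj.
    by rewrite -residue_mod expn0 modz1.
  by apply/eqP; apply: contrapT => /negP /minj; rewrite ltnn.
have [u au] := residue_eq0 aj0; exists j, u; split=> //.
apply: residue1_unit; apply: contra aj => /eqP u1.
have [v uv] := residue_eq0 u1.
rewrite au uv mulrA -exprD -natrX addn1.
by rewrite -[X in X == 0]/(((p ^ j.+1)%N%:R : Zp) j.+1 * _ %% _)%Z residue_natr modzz mul0r mod0z.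
Qed.

Lemma Zp_pchar0 m : (m%:R == 0 :> Zp) = (m == 0)%N.
Proof.
apply/eqP/eqP => [m0|->] //; have := congr1 (fun b : Zp => b m) m0.
rewrite residue_natr [RHS]mod0z modz_small => [[]//|].
by rewrite /= ltz_nat ltn_expl ?prime_gt1.
Qed.

Lemma Qp_pchar0 m : (m%:R == 0 :> Qp) = (m == 0)%N.
Proof. by rewrite -Zp_pchar0 -(rmorph_nat frac) tofrac_eq0. Qed.

Lemma p_neq0 : p%:R != 0 :> Qp.
Proof. by rewrite Qp_pchar0 -lt0n prime_gt0. Qed.

Lemma Qp_factor x : x != 0 ->
  exists k : int, exists2 u : Zp, u \is a GRing.unit & x = p%:R ^ k * frac u.
Proof.
have [a [b [b0 ->]]] := fraction_quot x; rewrite mulf_eq0 invr_eq0 !tofrac_eq0.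
rewrite (negPf b0) orbF => /padic_factor[i [u [uu ->]]].
have [j [v [uv ->]]] := padic_factor b0.
exists (i%:Z - j%:Z), (u / v); first by rewrite unitrMl ?unitrV.
have fV : frac v^-1 = (frac v)^-1 by rewrite rmorphV.
rewrite !tofracM !tofracXn !rmorph_nat fV.
rewrite expfzDr ?p_neq0 // -exprnN invfM.
by rewrite -!mulrA; congr (_ * _); rewrite mulrCA.
Qed.

(** The fractional ideal p^j Z_p, that is, the elements of valuation at least [j], with 0 in all of
    them. *)
Definition pball (j : int) : set Qp := [set x | exists a, x = p%:R ^ j * frac a].

Lemma pballD j x y : pball j x -> pball j y -> pball j (x + y).
Proof. by move=> [a ->] [b ->]; exists (a + b); rewrite rmorphD mulrDr. Qed.

Lemma pballM i j x y : pball i x -> pball j y -> pball (i + j) (x * y).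
Proof.
move=> [a ->] [b ->]; exists (a * b).
by rewrite rmorphM expfzDr ?p_neq0 // mulrACA.
Qed.

Lemma pballN j x : pball j x -> pball j (- x).
Proof. by case=> a ->; exists (- a); rewrite rmorphN mulrN. Qed.

Lemma pball0 j : pball j 0.
Proof. by exists 0; rewrite rmorph0 mulr0. Qed.

Lemma pball1 : pball 0 1.
Proof. by exists 1; rewrite rmorph1 mulr1. Qed.

Lemma pballS i j x : i <= j -> pball j x -> pball i x.
Proof.
rewrite -subr_ge0 => /gez0_abs e [a ->]; exists (p%:R ^+ absz (j - i) * a).
rewrite rmorphM rmorphXn rmorph_nat mulrA -[_ ^+ _]/(p%:R ^ (absz (j - i))%:Z) e.
by rewrite -expfzDr ?p_neq0 // addrC subrK.
Qed.

Lemma pball_exists x : exists j, pball j x.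
Proof.
have [->|/Qp_factor[k [u _ ->]]] := eqVneq x 0; first by exists 0; apply: pball0.
by exists k, u.
Qed.

Lemma pball_total j x : pball j x \/ x != 0 /\ pball (1 - j) x^-1.
Proof.
have [->|x0] := eqVneq x 0; first by left; apply: pball0.
have [k [u uu xE]] := Qp_factor x0.
have [jk|kj] := lerP j k; first by left; apply: (pballS jk); exists u.
right; split=> //; apply: (@pballS _ (- k)); first by rewrite -opprB lerN2 lerBrDr lezD1.
by exists u^-1; rewrite xE invfM rmorphV // -invr_expz.
Qed.

Lemma pball_eq0 x : (forall j : nat, pball j x) -> x = 0.
Proof.
move=> px; apply/eqP; apply: contrapT => /negP/Qp_factor[k [u uu xE]].
have [a] : pball (k + 1) x.
  by apply: (@pballS _ (absz (k + 1))) => //; rewrite abszE ler_norm.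
rewrite xE expfzDr ?p_neq0 // -mulrA => /mulfI.
rewrite expfz_neq0 ?p_neq0 // => /(_ isT)/eqP.
rewrite expr1z -(rmorph_nat frac) -rmorphM tofrac_eq => /eqP ua.
have := unit_residue1 uu; rewrite ua.
by rewrite -[X in X != 0]/((p%:R : Zp) 1%N * _ %% _)%Z residue_natr expn1 modzz mul0r mod0z.
Qed.

Lemma padic_val_pball x : pball (padic_val x) x.
Proof.
have [->|x0] := eqVneq x 0; first exact: pball0.
rewrite /padic_val; case: xgetP => [k _ [u _ e]|/= nex]; first by exists u.
by have [k ux] := Qp_factor x0; case: (nex k).
Qed.

End PadicNumbers.

(** * Limits along an ultrafilter *)

Section Ultralimits.
Variables (p : nat) (p_pr : prime p).
Local Notation Qp := (Qp p_pr).
Local Notation pball := (@pball p p_pr).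
Variable G : set (set nat).
Hypotheses (GU : UltraFilter G) (coG : (eventually `<=` G)%classic).
Implicit Types (a b : nat -> Qp) (l m : Qp).

(** Closeness is only asked on a set of the ultrafilter, so bounded sequences have limits without
    extracting subsequences; by [coG], ordinary limits are preserved. *)
Definition ulim a l := forall j : nat, G [set n | pball j%:Z (a n - l)]%classic.

Lemma ulim_cst l : ulim (fun=> l) l.
Proof.
by move=> j; apply: filterS filterT => n _ /=; rewrite subrr; apply: pball0.
Qed.

Lemma ulimD a b l m : ulim a l -> ulim b m -> ulim (fun n => a n + b n) (l + m).
Proof.
move=> al bm j; apply: filterS (filterI (al j) (bm j)) => n [/= an bn].
by rewrite opprD addrACA; apply: pballD.
Qed.

Lemma ulimM a b l m : ulim a l -> ulim b m -> ulim (fun n => a n * b n) (l * m).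
Proof.
have bounded x : exists c : nat, pball (- c%:Z) x.
  have [i xi] := pball_exists x; exists (absz i); apply: pballS xi.
  by rewrite lerNl abszE -normrN ler_norm.
have [c lc] := bounded l; have [d md] := bounded m.
move=> al bm j.
apply: filterS (filterI (al (j + d)%N) (bm (j + c)%N)) => n [/= an bn].
have bnd : pball (- d%:Z) (b n).
  rewrite -[b n](subrK m); apply: pballD md; apply: pballS bn.
  by rewrite PoszD; lia.
have -> : a n * b n - l * m = (a n - l) * b n + l * (b n - m).
  by rewrite mulrBl mulrBr addrA subrK.
apply: pballD.
  by rewrite -[j%:Z](addrK d%:Z) -PoszD; apply: pballM.
by rewrite -[j%:Z](addKr c%:Z) -PoszD addnC; apply: pballM.
Qed.

Lemma ulim_sum (I : Type) (r : seq I) (f : I -> nat -> Qp) (l : I -> Qp) :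
  (forall i, ulim (f i) (l i)) -> ulim (fun n => \sum_(i <- r) f i n) (\sum_(i <- r) l i).
Proof.
move=> fl; elim: r => [|i r IHr].
  rewrite big_nil (_ : (fun _ => _) = fun=> 0); first exact: ulim_cst.
  by apply/funext => n; rewrite big_nil.
rewrite big_cons (_ : (fun _ => _) = fun n => f i n + \sum_(j <- r) f j n).
  exact: ulimD.
by apply/funext => n; rewrite big_cons.
Qed.

Lemma ulim_prod (I : Type) (r : seq I) (f : I -> nat -> Qp) (l : I -> Qp) :
  (forall i, ulim (f i) (l i)) -> ulim (fun n => \prod_(i <- r) f i n) (\prod_(i <- r) l i).
Proof.
move=> fl; elim: r => [|i r IHr].
  rewrite big_nil (_ : (fun _ => _) = fun=> 1); first exact: ulim_cst.
  by apply/funext => n; rewrite big_nil.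
rewrite big_cons (_ : (fun _ => _) = fun n => f i n * \prod_(j <- r) f j n).
  exact: ulimM.
by apply/funext => n; rewrite big_cons.
Qed.

Lemma ulim_unique a l m : ulim a l -> ulim a m -> l = m.
Proof.
move=> al am; apply/eqP; rewrite -subr_eq0; apply/eqP/(@pball_eq0 _ p_pr) => j.
have [n [/= aln amn]] := filter_ex (filterI (al j) (am j)).
have -> : l - m = (a n - m) - (a n - l) by rewrite opprB [RHS]addrC addrA subrK.
exact/pballD/pballN.
Qed.

Lemma ulim_null a (c : int) : (forall n, pball (n%:Z - c) (a n)) -> ulim a 0.
Proof.
move=> ac j; apply: coG; exists (absz (j%:Z + c)) => // n /= jn.
rewrite subr0; apply: pballS (ac n).
rewrite lerBrDr; apply: le_trans (_ : (absz (j%:Z + c))%:Z <= _) => //.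
by rewrite abszE ler_norm.
Qed.

(** If no fibre were in [G], all their complements would be, and excluding the values one by one
    would make [f] at least [k] on a set of [G]. *)
Lemma ultra_pigeonhole (f : nat -> nat) k : (forall n, (f n < k)%N) ->
  exists r, G [set n | f n = r]%classic.
Proof.
move=> fk; apply: contrapT => nex.
suff H i : G [set n | (i <= f n)%N]%classic.
  by have [n /=] := filter_ex (H k); rewrite leqNgt fk.
elim: i => [|i IHi]; first by apply: filterS filterT.
have [Gi|Gi] := in_ultra_setVsetC [set n | f n = i]%classic GU; first by case: nex; exists i.
apply: filterS (filterI IHi Gi) => n [/= le ne].
by rewrite ltn_neqAle le andbT eq_sym; apply/eqP.
Qed.

(** Compactness of Z_p: each residue takes finitely many values, so it is constant on a set of [G];
    these constants are coherent because two sets of [G] meet. *)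
Lemma ulim_exists a : (forall n, pball 0 (a n)) -> exists l, ulim a l.
Proof.
move=> a0; have /choice[b ab] : forall n, exists c : padic_int p_pr, a n = FracField.tofrac c.
  by move=> n; have [c ->] := a0 n; exists c; rewrite expr0z mul1r.
have /choice[f fP] : forall j, exists r, G [set n | b n j = r]%classic.
  move=> j; have [n|r Gr] := @ultra_pigeonhole (fun n => absz (b n j)) (p ^ j)%N.
    by rewrite -ltz_nat abszE ger0_norm ?residue_ge0 // residue_lt.
  exists r%:Z; apply: filterS Gr => n /= <-.
  by rewrite abszE ger0_norm ?residue_ge0.
have fc : `[< coherent p f >].
  apply/asboolP => i j ij; have [n [/= <- <-]] := filter_ex (filterI (fP i) (fP j)).
  exact: padic_intP.
pose l := PadicInt p_pr fc; exists (FracField.tofrac l) => j.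
apply: filterS (fP j) => n /= bnj; rewrite ab -rmorphB.
have [c ->] : exists c, b n - l = p%:R ^+ j * c.
  apply: residue_eq0; rewrite -[LHS]/((b n j + (- f j %% _)%Z) %% _)%Z.
  by rewrite modzDmr bnj subrr mod0z.
by exists c; rewrite rmorphM rmorphXn rmorph_nat.
Qed.

(** * Coordinatewise limits in [N] *)

Variable N : splittingFieldType Qp.
Local Notation B := (vbasis {:N}).
Implicit Types (x y : nat -> N).

(** Limits are taken in coordinates and not for [valN]: products, automorphisms and the norm are
    polynomial in the coordinates, hence continuous. *)
Definition vlim x (v : N) := forall i, ulim (fun n => coord B i (x n)) (coord B i v).

Lemma vlim_unique x v w : vlim x v -> vlim x w -> v = w.
Proof.
move=> xv xw; rewrite (coord_vbasis (memvf v)) (coord_vbasis (memvf w)).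
by apply: eq_bigr => i _; rewrite (ulim_unique (xv i) (xw i)).
Qed.

Lemma vlim_linear (f : {linear N -> N}) x v : vlim x v -> vlim (f \o x) (f v).
Proof.
have coordE i w : coord B i (f w) = \sum_j coord B j w * coord B i (f B`_j).
  rewrite {1}(coord_vbasis (memvf w)) !linear_sum; apply: eq_bigr => j _.
  by rewrite !linearZ.
move=> xv i; rewrite coordE (_ : (fun _ => _)
    = fun n => \sum_j coord B j (x n) * coord B i (f B`_j)).
  by apply: ulim_sum => j; apply: ulimM => //; apply: ulim_cst.
by apply/funext => n; rewrite /= coordE.
Qed.

Lemma vlim_mul x y v w : vlim x v -> vlim y w -> vlim (fun n => x n * y n) (v * w).
Proof.
have coordE i t u : coord B i (t * u)
    = \sum_j \sum_k coord B j t * coord B k u * coord B i (B`_j * B`_k).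
  rewrite {1}(coord_vbasis (memvf t)) {1}(coord_vbasis (memvf u)).
  rewrite mulr_suml linear_sum; apply: eq_bigr => j _.
  rewrite mulr_sumr linear_sum; apply: eq_bigr => k _.
  by rewrite -scalerAl -scalerAr !linearZ /= mulrA.
move=> xv yw i; rewrite coordE (_ : (fun _ => _) = fun n => \sum_j \sum_k
    coord B j (x n) * coord B k (y n) * coord B i (B`_j * B`_k)).
  apply: ulim_sum => j; apply: ulim_sum => k.
  by apply: ulimM; [apply: ulimM | apply: ulim_cst].
by apply/funext => n; rewrite coordE.
Qed.

Lemma vlim_galNorm x v : vlim x v ->
  vlim (fun n => galNorm 1 {:N} (x n)) (galNorm 1 {:N} v).
Proof.
move=> xv; rewrite /galNorm; elim: (index_enum _) => [|g r IHr].
  rewrite big_nil (_ : (fun _ => _) = fun=> 1); first by move=> i; apply: ulim_cst.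
  by apply/funext => n; rewrite big_nil.
rewrite big_cons (_ : (fun _ => _) = fun n => if g \in 'Gal({:N} / 1)%g
  then g (x n) * \prod_(h <- r | h \in 'Gal({:N} / 1)%g) h (x n)
  else \prod_(h <- r | h \in 'Gal({:N} / 1)%g) h (x n)).
  by case: ifP => // _; apply: vlim_mul => //; apply: vlim_linear.
by apply/funext => n; rewrite big_cons.
Qed.

End Ultralimits.

(** * Valuations, limits and automorphisms of N *)

Section LimitUniqueness.
Variables (p : nat) (p_pr : prime p) (N : splittingFieldType (Qp p_pr)).
Local Notation pball := (@pball p p_pr).
Local Notation B := (vbasis {:N}).
Hypothesis galN : galois 1 {:N}.

Lemma scalarN_inj : injective (fun a : Qp p_pr => a%:A : N).
Proof.
by move=> a b /eqP; rewrite -subr_eq0 -scalerBl scaler_eq0 oner_eq0 orbF subr_eq0 => /eqP.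
Qed.

Lemma galNorm_scale (a : Qp p_pr) (x : N) :
  galNorm 1 {:N} (a *: x) = a ^+ #|'Gal({:N} / 1)%g| *: galNorm 1 {:N} x.
Proof.
rewrite /galNorm -prodr_const -scaler_prod; apply: eq_bigr => g _.
by rewrite linearZ.
Qed.

(** The index [i] is that of a coordinate of least valuation. *)
Lemma pivot (I : finType) (c : I -> Qp p_pr) k i0 : ~ pball k (c i0) ->
  exists i, [/\ c i != 0, pball (- k) (c i)^-1 & forall j, pball 0 (c j / c i)].
Proof.
move=> ci0; have [b cb] : exists b : nat, forall i, pball (- b%:Z) (c i).
  have /choice[f fP] i : exists j, pball j (c i) by apply: pball_exists.
  exists (\max_i absz (f i))%N => i; apply: pballS (fP i).
  by have := leq_bigmax (F := fun i => absz (f i)) i; move: (f i); lia.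
(* The shift by [b] turns the search for the least valuation into one over [nat]. At the minimum
   [t.+1], all coordinates lie in the ball of index [t - b] and some coordinate is not in the next
   one. *)
pose P t := `[< exists i, ~ pball (t%:Z - b%:Z) (c i) >].
have exP : exists t, P t.
  exists (absz (k + b)); apply/asboolP; exists i0; apply: contra_not ci0.
  by apply: pballS; lia.
case: (ex_minnP exP) => -[|t] /asboolP[i ci] mint.
  by case: ci; rewrite sub0r.
have ct j : pball (t%:Z - b%:Z) (c j).
  apply: contrapT => cj; have /mint : P t by apply/asboolP; exists j.
  by rewrite ltnn.
have [//|[i_n0 iV]] := pball_total (t.+1%:Z - b%:Z) (c i).
have leVt : - (t%:Z - b%:Z) <= 1 - (t.+1%:Z - b%:Z) by lia.
exists i; split=> // [|j].
  apply: pballS iV; have [|] := lerP (t%:Z - b%:Z + 1) k; first lia.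
  by move=> ltk; case: ci0; apply: pballS (ct i0); lia.
by rewrite -(subrr (t%:Z - b%:Z)); apply/pballM/(pballS leVt).
Qed.

(* By compactness of Z_p, the norm is bounded away from 0 on vectors normalized
   so that their largest coordinate is 1. *)
Lemma pball_norm_coord (x : nat -> N) (k : int) (i0 : 'I_(\dim {:N})) :
  (forall n : nat, pball n (normQp (x n))) -> ~ (forall n, ~ pball k (coord B i0 (x n))).
Proof.
move=> normx xk; have [G [GU coG]] := ultraFilterLemma eventually_filter.
have /choice[h hP] n := pivot (c := fun i => coord B i (x n)) (xk n).
(* Division by the largest coordinate: [y n] has coordinates in Z_p, one of them equal to 1. *)
pose c n := (coord B (h n) (x n))^-1; pose y n := c n *: x n.
have coord_y i n : coord B i (y n) = coord B i (x n) * c n.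
  by rewrite linearZ /= mulrC.
have /choice[l yl] i : exists l, ulim G (fun n => coord B i (y n)) l.
  by apply: ulim_exists => // n; rewrite coord_y; have [_ _] := hP n.
pose v := \sum_i l i *: B`_i.
have coord_v i : coord B i v = l i.
  by rewrite coord_sum_free // (basis_free (vbasisP _)).
have yv : vlim G y v by move=> i; rewrite coord_v.
pose d := #|'Gal({:N} / 1)%g|.
have norm_y n : galNorm 1 {:N} (y n) = (c n ^+ d * normQp (x n))%:A.
  by rewrite galNorm_scale -scalerA normQpE.
have norm_y0 : vlim G (fun n => galNorm 1 {:N} (y n)) 0.
  move=> i; rewrite linear0 -[0](mul0r (coord B i 1)).
  rewrite (_ : (fun _ => _) = fun n => c n ^+ d * normQp (x n) * coord B i 1).
    apply: (ulimM GU); last exact: ulim_cst.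
    (* The factor [c n ^+ d] has valuation at least [- k * d], a bound independent of [n], whereas
       the norm of [x n] has valuation at least [n]. *)
    apply: (@ulim_null _ _ _ coG _ (k * d%:Z)) => n; rewrite addrC -mulNr.
    apply: pballM => //; have [_ cn _] := hP n; elim: (d) => [|e IHe].
      by rewrite mulr0; apply: pball1.
    by rewrite exprS intS mulrDr mulr1; apply: pballM.
  by apply/funext => n; rewrite norm_y linearZ.
have /eqP := vlim_unique GU (vlim_galNorm GU yv) norm_y0.
rewrite galNorm_eq0 => /eqP v0.
(* The coordinate of [y n] equal to 1 depends on [n]; the product vanishes whichever it is, and this
   passes to the limit. It contradicts [v = 0], where every factor is -1. *)
have : \prod_i (l i - 1) = 0.
  apply: (ulim_unique GU (a := fun n => \prod_i (coord B i (y n) - 1))).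
    by apply: (ulim_prod GU) => i; apply: (ulimD GU) => //; apply: ulim_cst.
  rewrite (_ : (fun _ => _) = fun=> 0); first exact: ulim_cst.
  apply/funext => n; apply/eqP; rewrite prodf_seq_eq0; apply/hasP.
  exists (h n); rewrite ?mem_index_enum //= coord_y subr_eq0.
  by have [c0 _ _] := hP n; rewrite divff.
move/eqP; rewrite prodf_seq_eq0 => /hasP[i _ /=].
by rewrite -coord_v v0 linear0 sub0r oppr_eq0 oner_eq0.
Qed.

Lemma pball_normQp (m : nat) (x : N) : ((m%:R : rat)%:E <= valN x)%E -> pball m (normQp x).
Proof.
rewrite /valN; have [-> _|x0] := eqVneq x 0.
  suff -> : normQp (0 : N) = 0 by apply: pball0.
  by apply: scalarN_inj; rewrite normQpE // galNorm0 scale0r.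
have d0 : 0 < (\dim {:N})%:R :> rat by rewrite ltr0n adim_gt0.
rewrite lee_fin ler_pdivlMr // => le; apply: pballS (padic_val_pball _).
rewrite -(ler_int rat); apply: le_trans le; rewrite ler_peMr ?ler0n //.
by rewrite ler1n adim_gt0.
Qed.

(** If [l] and [l'] differ, some coordinate of [l - l'] is outside a ball. For a term [w] close to
    both, [w - l] or [w - l'] has that coordinate outside the ball too, although both have small
    norm. *)
Lemma converges_unique (u : nat -> N) l l' :
  converges u l -> converges u l' -> l = l'.
Proof.
move=> ul ul'; apply: contrapT => /eqP; rewrite -subr_eq0 => d0.
have [i [k dk]] : exists i (k : nat), ~ pball k (coord B i (l - l')).
  apply: contrapT => nex; case/eqP: d0.
  rewrite (coord_vbasis (memvf (l - l'))) big1 // => i _.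
  rewrite [coord _ _ _](@pball_eq0 _ p_pr) ?scale0r // => k.
  by apply: contrapT => ik; apply: nex; exists i, k.
have /choice[x xP] (n : nat) : exists x : N,
    pball n (normQp x) /\ ~ pball k (coord B i x).
  have [m um] := ul n%:R; have [m' um'] := ul' n%:R.
  have {um} := pball_normQp (um _ (leq_maxl m m')).
  have {um'} := pball_normQp (um' _ (leq_maxr m m')).
  set w := u _ => nl' nl.
  have [wl|] := pselect (pball k (coord B i (w - l))); last by exists (w - l).
  exists (w - l'); split=> //; apply: contra_not dk => wl'.
  have -> : l - l' = (w - l') - (w - l) by rewrite opprB [RHS]addrC addrA subrK.
  by rewrite linearB; apply/pballD/pballN.
by apply: (@pball_norm_coord x k i) => n; have [] := xP n.
Qed.

(** * Automorphisms and valuations, congruences, logarithms *)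

Lemma galNorm_AEnd (s : 'AEnd(N)) x : galNorm 1 {:N} (s x) = galNorm 1 {:N} x.
Proof.
have sN : (s @: {:N} <= {:N})%VS by apply: subvf.
rewrite -(galK sN (memvf x)) galNorm_gal ?memvf //.
by rewrite gal_kHom ?sub1v // k1HomE ahomWin.
Qed.

Lemma eq_galNorm_valN (x y : N) :
  galNorm 1 {:N} x = galNorm 1 {:N} y -> valN x = valN y.
Proof.
move=> e; rewrite /valN -(galNorm_eq0 1 {:N} x) -(galNorm_eq0 1 {:N} y) e.
suff -> : normQp x = normQp y by [].
by apply: scalarN_inj; rewrite !normQpE.
Qed.

Lemma valN_AEnd (s : 'AEnd(N)) x : valN (s x) = valN x.
Proof. exact/eq_galNorm_valN/galNorm_AEnd. Qed.

Lemma valring_gal (M : {subfield N}) (s : gal_of M) x :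
  valring M x -> valring M (s x).
Proof. by case=> Mx x0; split; rewrite ?memv_gal ?valN_AEnd. Qed.

(** The automorphism may move [pi], but [s pi / pi] has norm 1, so it can be absorbed in the
    integral cofactor. *)
Lemma cong_mod_gal (M : {subfield N}) (s : gal_of M) pi x y :
  uniformizer M pi -> cong_mod M pi x y -> cong_mod M pi (s x) (s y).
Proof.
case=> Mpi pi0 _ _ [t [Mt t0] e]; exists (s pi / pi * s t); last first.
  by rewrite -rmorphB e rmorphM mulrA [pi * _]mulrC divfK.
split; first by rewrite !rpredM ?rpredV ?memv_gal.
rewrite (eq_galNorm_valN (y := t)) // !galNormM galNormV !galNorm_AEnd.
by rewrite divff ?mul1r // galNorm_eq0.
Qed.

Lemma converges_AEnd (s : 'AEnd(N)) u l : converges u l -> converges (s \o u) (s l).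
Proof.
by move=> ul c; have [m um] := ul c; exists m => n /um; rewrite /= -rmorphB valN_AEnd.
Qed.

Lemma padic_log_AEnd (s t : 'AEnd(N)) y : cancel s t ->
  padic_log (s y) = s (padic_log y).
Proof.
move=> sK; have logE (r : 'AEnd(N)) w l :
    converges (fun n => \sum_(1 <= m < n.+1) (-1) ^+ m.-1 * (w - 1) ^+ m / m%:R) l ->
    converges (fun n => \sum_(1 <= m < n.+1) (-1) ^+ m.-1 * (r w - 1) ^+ m / m%:R) (r l).
  move=> /(converges_AEnd r); congr converges; apply/funext => n /=.
  rewrite rmorph_sum; apply: eq_bigr => m _.
  by rewrite fmorph_div rmorphM !rmorphXn rmorphB rmorphN !rmorph1 rmorph_nat.
(* By [logE] for [s] and for its inverse [t], the two series converge together; if both diverge,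
   both logarithms take the dummy value 0, which [s] fixes. *)
rewrite /padic_log; case: xgetP => [l _ /= ul|nl]; case: xgetP => [l' _ /= ul'|nl'].
- exact/(converges_unique ul)/logE.
- by case: (nl' (t l)); rewrite -[y]sK; apply: logE.
- by case: (nl (s l')); apply: logE.
by rewrite rmorph0.
Qed.

End LimitUniqueness.

Theorem proposition2p8 (p : nat) (p_pr : prime p)
    (gT : finGroupType) (n : nat) (n_gT : #|gT| = n)
    (N : splittingFieldType (Qp p_pr)) (galN : galois 1 {:N})
    (unityN : exists rs : seq N,
        'X^n - 1 = \prod_(w <- rs) ('X - w%:P) :> {poly N})
    (K M : {subfield N}) (sKM : (K <= M)%VS) (galM : galois K M)
    (piK piM : N) (piKP : uniformizer K piK) (piMP : uniformizer M piM)
    (q : nat) (k : finFieldType) (card_k : #|k| = (p ^ q)%N)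
    (r : N -> k) (rP : residue_map K piK r)
    (F sigma : gal_of M) (F_gal : F \in 'Gal(M / K)%g)
    (sigma_gal : sigma \in 'Gal(M / K)%g)
    (FP : frobenius_lift piM (p ^ q) F) :
  frobenius_lift piM (p ^ q) (galconj sigma F) /\
  forall tau : gal_of {:N}, tau \in 'Gal({:N} / K)%g -> {in M, tau =1 sigma} ->
  forall z : {ffun gT -> N}, grunit (valring M) z ->
  LogF (p ^ q) (galconj sigma F) (grmap sigma z)
    = homaction tau (LogF (p ^ q) F z).
Proof.
have frob : frobenius_lift piM (p ^ q) (galconj sigma F).
  move=> x Ox; have [Mx _] := Ox; rewrite galconjE //.
  (* Only the [x] in the power is rewritten: the claim becomes the image under [sigma] of the
     congruence for [F] at the preimage of [x]. *)
  have {2}<- : sigma ((sigma^-1)%g x) = x by rewrite -galois.galM // mulVg gal_id.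
  rewrite -rmorphXn; apply: (@cong_mod_gal _ _ _ galN M sigma _ _ _ piMP).
  by apply/FP/valring_gal.
split=> // tau _ tauE z uz; apply/funext => X.
have Mz g : z g \in M by have [/(_ g)[]] := uz.
have N0 : [pchar N] =i pred0.
  apply/pcharf0P => m; rewrite -(Qp_pchar0 p_pr) -scaler_nat scaler_eq0 oner_eq0.
  by rewrite orbF.
have tauK : cancel tau (tau^-1)%g.
  by move=> x; rewrite -galois.galM ?memvf // mulgV gal_id.
have tauVK : cancel (tau^-1)%g tau.
  by move=> x; rewrite -galois.galM ?memvf // mulVg gal_id.
(* The coefficients of [z] lie in [M], where [tau] and [sigma] agree; [tau] is defined on all of
   [N], where determinants and logarithms take their values. *)
have -> : grmap sigma z = grmap tau z by apply/ffunP => g; rewrite !ffunE tauE.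
have eF : grmap (galconj sigma F) (grmap tau z) = grmap tau (grmap F z).
  apply/ffunP => g; rewrite !ffunE !tauE ?memv_gal ?Mz // galconjE ?memv_gal ?Mz //.
  by rewrite -(galois.galM sigma (sigma^-1)%g) ?Mz // mulgV gal_id.
(* On the right, [tau] is moved through the logarithm, the quotient and the power; numerator and
   denominator are then compared separately. *)
rewrite /homaction /LogF eF -(padic_log_AEnd galN _ tauK) fmorph_div rmorphXn.
rewrite (Det_grmap_adams tauVK _ _ N0 (grunit_map F uz)).
by rewrite (Det_grmap tauVK _ uz).
Qed.
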